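(* Let $c\ge 2$ and $k\ge 1$ be integers and let $(b_n)_{n\ge 1}$ be a sequence of complex numbers such that the series $A_c=\sum_{n=1}^{\infty}a_{c,n}b_n$ converges. Then the series $\sum_{n=1}^{\infty}a_{c,n}\Delta_c^k b_n$ also converges, and $$A_c=\sum_{j=0}^{k-1}\frac{(-1)^j}{c^{j+1}}\left(\sum_{i=0}^{c-2}(c+i)\,\Delta_c^j b_{i+1}-(c-1)^2\,\Delta_c^j b_c\right)+\sum_{n=1}^{\infty}\frac{(-1)^k}{c^k}\,a_{c,n}\,\Delta_c^k b_n .$$
   Context: For an integer $c\ge 2$ and an integer $n\ge1$, set $a_{c,n}=1-c$ if $n\equiv 0 \pmod c$ and $a_{c,n}=1$ if $n\not\equiv 0\pmod c$. For a complex sequence $(b_n)_{n\ge1}$, the generalized difference operators $\Delta_c^k$ are defined recursively by $\Delta_c^0 b_n=b_n$ and $\Delta_c^k b_n=\sum_{i=1}^{c}a_{c,i}\,\Delta_c^{k-1}b_{n+i}$ for $k\ge 1$, $n\ge 1$. Convergence of series means convergence of the usual partial sums. *)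

(* Defs.v *)
From Stdlib Require Import Reals Arith.
From Coquelicot Require Import Coquelicot.

Open Scope C_scope.

(* A sequence indexed by n >= 1 is a function on nat; its value at 0 plays no
   role: [delta c k b n] only reads b at indices >= n, and series over n >= 1
   are written with the shifted index [S n]. *)

Definition acoef (c n : nat) : C :=
  if Nat.eqb (n mod c) 0 then 1 - INR c else 1.

Fixpoint delta (c k : nat) (b : nat -> C) (n : nat) : C :=
  match k with
  | O => b n
  | S k' => sum_n_m (fun i => acoef c i * delta c k' b (n + i)%nat) 1 c
  end.

(* Main.v *)
Require Import Defs.
From Stdlib Require Import Reals Arith Lra Lia.
From Coquelicot Require Import Coquelicot.

(** Write [a = acoef c] and view it as a function on Z/c, namely 1 minus [c]
    times the indicator of 0.  Its cyclic convolution square is [- c] times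
    itself: with [u] the constant function 1 and [d] the indicator of 0,
    [u*u = c u], [u*d = u] and [d*d = d], so [a*a = c u - 2 c u + c^2 d].

    Substituting the definition of [delta c 1 b] in the N-th partial sum of
    [a_n * delta c 1 b n] and collecting the coefficient of each [b_m], a middle
    index [m] receives the full convolution, that is [- c * a_m].  Only indices
    near the two ends are incomplete.  The left end contributes the explicit
    bracket of the formula ([head_term]); the right end ([edge]) involves the
    [c] values [b (N+1), ..., b (N+c)] with bounded coefficients.  The exact
    identity is [partial_sum_delta].

    Convergence of the series of [a_n * b_n] forces [b_n] to tend to 0, because
    [|a_n| >= 1] when [c >= 2]; hence the right end vanishes in the limit and
    the sum of [a_n * delta c 1 b n] is [head_term - c * A]
    ([is_series_delta_1]).  This solves for [A], which is the case [k = 1].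
    Since [delta c (S k) b] is the first difference of [delta c k b], iterating
    this step gives the general formula. *)

Local Open Scope C_scope.

(** * Finite sums in the complex numbers *)

(** The general summation lemmas produce equalities in the carrier of an
    abelian monoid, where [ring] does not recognise the complex numbers; these
    instances are stated over [C] with [Cplus] and [Cmult]. *)
Lemma csum_first (u : nat -> C) (n m : nat) :
  (n <= m)%nat -> sum_n_m u n m = u n + sum_n_m u (S n) m :> C.
Proof. exact (sum_Sn_m u n m). Qed.

Lemma csum_last (u : nat -> C) (n m : nat) :
  (n <= S m)%nat -> sum_n_m u n (S m) = sum_n_m u n m + u (S m) :> C.
Proof. exact (sum_n_Sm u n m). Qed.

Lemma csum_empty (u : nat -> C) (n m : nat) :
  (m < n)%nat -> sum_n_m u n m = 0 :> C.
Proof. exact (sum_n_m_zero u n m). Qed.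

Lemma csum_ext (u v : nat -> C) (n m : nat) :
  (forall i, (n <= i <= m)%nat -> u i = v i) ->
  sum_n_m u n m = sum_n_m v n m :> C.
Proof. exact (sum_n_m_ext_loc u v n m). Qed.

Lemma csum_single (u : nat -> C) (n : nat) : sum_n_m u n n = u n :> C.
Proof. exact (sum_n_n u n). Qed.

Lemma csum_shift (u : nat -> C) (n m : nat) :
  sum_n_m (fun i => u (S i)) n m = sum_n_m u (S n) (S m) :> C.
Proof. exact (sum_n_m_S u n m). Qed.

Lemma csum_plus (u v : nat -> C) (n m : nat) :
  sum_n_m (fun i => u i + v i) n m = sum_n_m u n m + sum_n_m v n m :> C.
Proof. exact (sum_n_m_plus u v n m). Qed.

Lemma csum_mult_l (z : C) (u : nat -> C) (n m : nat) :
  sum_n_m (fun i => z * u i) n m = z * sum_n_m u n m :> C.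
Proof. exact (sum_n_m_mult_l (K := C_Ring) z u n m). Qed.

Lemma csum_opp (u : nat -> C) (n m : nat) :
  sum_n_m (fun i => - u i) n m = - sum_n_m u n m :> C.
Proof.
  rewrite (csum_ext _ (fun i => - (1) * u i)).
  - rewrite csum_mult_l. ring.
  - intros i _. ring.
Qed.

Lemma csum_one (n m : nat) :
  (n <= S m)%nat -> sum_n_m (fun _ => 1 : C) n m = INR (S m) - INR n :> C.
Proof.
  induction m as [|m IH]; intros Hnm.
  - destruct n as [|[|n]]; [| |lia].
    + rewrite csum_single. simpl. ring.
    + rewrite csum_empty by lia. simpl. ring.
  - destruct (Nat.eq_dec n (S (S m))) as [->|Hne].
    + rewrite csum_empty by lia. ring.
    + rewrite csum_last, IH by lia.
      rewrite (S_INR (S m)), RtoC_plus. ring.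
Qed.

(** * The periodic coefficients *)

Lemma acoef_period (c n : nat) : acoef c (n + c) = acoef c n.
Proof.
  unfold acoef. destruct c as [|d]; [now rewrite Nat.add_0_r|].
  replace (n + S d)%nat with (n + 1 * S d)%nat by lia.
  now rewrite Nat.Div0.mod_add.
Qed.

Lemma acoef_0 (c : nat) : acoef c 0 = 1 - INR c.
Proof.
  unfold acoef. now rewrite Nat.Div0.mod_0_l.
Qed.

Lemma acoef_self (c : nat) : acoef c c = 1 - INR c.
Proof. rewrite <- (acoef_0 c). exact (acoef_period c 0). Qed.

Lemma acoef_small (c i : nat) : (0 < i < c)%nat -> acoef c i = 1.
Proof.
  intros Hi. unfold acoef. rewrite Nat.mod_small by lia.
  destruct i; [lia|reflexivity].
Qed.

Lemma acoef_cases (c n : nat) : acoef c n = 1 - INR c \/ acoef c n = 1.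
Proof. unfold acoef. destruct (Nat.eqb _ _); auto. Qed.

Lemma Cmod_acoef_le (c n : nat) : (1 <= c)%nat -> (Cmod (acoef c n) <= INR c)%R.
Proof.
  intros Hc. apply le_INR in Hc. simpl in Hc.
  destruct (acoef_cases c n) as [-> | ->].
  - rewrite <- RtoC_minus, Cmod_R. apply Rabs_le. lra.
  - now rewrite Cmod_1.
Qed.

(** This is where [c >= 2] matters: for [c = 1] all coefficients vanish, and
    convergence of the weighted series says nothing about the sequence. *)
Lemma Cmod_acoef_ge (c n : nat) : (2 <= c)%nat -> (1 <= Cmod (acoef c n))%R.
Proof.
  intros Hc. apply le_INR in Hc. simpl in Hc.
  destruct (acoef_cases c n) as [-> | ->].
  - rewrite <- RtoC_minus, Cmod_R, Rabs_minus_sym, Rabs_pos_eq; lra.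
  - rewrite Cmod_1. lra.
Qed.

Lemma sum_acoef_mult (c : nat) (x : nat -> C) :
  (1 <= c)%nat ->
  sum_n_m (fun i => acoef c i * x i) 1 c = sum_n_m x 1 c - INR c * x c :> C.
Proof.
  intros Hc. destruct c as [|d]; [lia|].
  rewrite !csum_last by lia. rewrite acoef_self.
  rewrite (csum_ext _ x 1 d).
  - ring.
  - intros i Hi. rewrite acoef_small by lia. ring.
Qed.

(** Over a full period one coefficient is [1 - c] and the other [c - 1] are 1.
    The descending index matches the convolution below; adding [c] keeps the
    subtraction of naturals exact without changing the value. *)
Lemma sum_acoef_window (c m : nat) :
  (1 <= c)%nat -> sum_n_m (fun i => acoef c (m + c - i)) 1 c = 0 :> C.
Proof.
  intros Hc. destruct c as [|d]; [lia|].
  induction m as [|m IH].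
  - rewrite csum_last by lia.
    replace (0 + S d - S d)%nat with O by lia. rewrite acoef_0.
    rewrite (csum_ext _ (fun _ => 1) 1 d).
    + rewrite csum_one by lia. simpl (INR 1). ring.
    + intros i Hi. apply acoef_small. lia.
  - rewrite csum_first by lia.
    rewrite <- (csum_shift (fun i => acoef (S d) (S m + S d - i)) 1 d).
    rewrite csum_last in IH by lia.
    replace (S m + S d - 1)%nat with (m + S d)%nat by lia.
    replace (m + S d - S d)%nat with m in IH by lia.
    rewrite acoef_period, <- IH, Cplus_comm. reflexivity.
Qed.

(** The weights [acoef c i] act as a plain sum minus [c] times the term
    [i = c]; the plain sum is a window of the coefficients, which vanishes. *)
Lemma acoef_convolution (c m : nat) :
  (1 <= c)%nat ->
  sum_n_m (fun i => acoef c i * acoef c (m + c - i)) 1 c = - (INR c * acoef c m) :> C.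
Proof.
  intros Hc. rewrite (sum_acoef_mult c (fun i => acoef c (m + c - i))) by lia.
  rewrite sum_acoef_window by lia.
  replace (m + c - c)%nat with m by lia. ring.
Qed.

(** * Partial sums of the differenced series *)

(** The part of the convolution at index [N + j] that comes from the pairs
    [(n, i)] with [n = N + j - i <= N]; the constraint reads [i >= j].  Here
    [n] runs over all integers, [n <= 0] included: by periodicity every index
    [1 <= m <= N] then carries a full convolution, at the price of fictitious
    terms, whose total is the edge at [N = 0].  The added [c] is one period, as in
    [sum_acoef_window]. *)
Definition edge_coef (c N j : nat) : C :=
  sum_n_m (fun i => acoef c i * acoef c (N + j + c - i)) j c.

(** For [N >= c] this is what the values of [b] beyond [N] contribute to the
    N-th partial sum of the differenced series. *)
Definition edge (c : nat) (b : nat -> C) (N : nat) : C :=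
  sum_n_m (fun j => edge_coef c N j * b (N + j)%nat) 1 c.

Definition head_term (c : nat) (b : nat -> C) : C :=
  sum_n_m (fun i => (INR c + INR i) * b (i + 1)%nat) 0 (c - 2)
  - (INR c - 1) ^ 2 * b c.

(** Moving [N] to [N + 1] adds the single pair [n = N + 1], [i = j] to those
    already counted for the same index [N + 1 + j = N + (j + 1)]. *)
Lemma edge_coef_succ (c N j : nat) :
  (j <= c)%nat ->
  edge_coef c (S N) j = acoef c j * acoef c (S N) + edge_coef c N (S j).
Proof.
  intros Hj. unfold edge_coef. rewrite csum_first by lia.
  replace (S N + j + c - j)%nat with (S N + c)%nat by lia.
  rewrite acoef_period. f_equal.
  apply csum_ext. intros i _. do 2 f_equal. lia.
Qed.

(** The pairs with [n = N + 1] make up the new term of the differenced series.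
    The index [N + 1] leaves the edge; all of its pairs are then counted, so by
    the convolution identity it leaves with coefficient [- c * a_(N+1)]. *)
Lemma edge_succ (c : nat) (b : nat -> C) (N : nat) :
  (1 <= c)%nat ->
  edge c b (S N) - edge c b N =
  acoef c (S N) * delta c 1 b (S N) + INR c * (acoef c (S N) * b (S N)).
Proof.
  intros Hc. unfold edge. simpl delta.
  set (w := fun j => edge_coef c N j * b (N + j)%nat).
  rewrite (csum_ext _
    (fun j => acoef c (S N) * (acoef c j * b (S N + j)%nat) + w (S j))).
  - rewrite csum_plus, csum_mult_l, (csum_shift w 1 c).
    (* The shift gains the term [c + 1], whose coefficient is an empty sum, and
       loses the term 1, whose coefficient is a full convolution. *)
    rewrite (csum_last w) by lia. rewrite (csum_first w 1) by lia.
    unfold w at 2 3. unfold edge_coef at 1 2.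
    rewrite (csum_empty _ (S c) c), (Nat.add_1_r N), acoef_convolution by lia.
    simpl. ring.
  - intros j Hj. unfold w. rewrite edge_coef_succ by lia.
    replace (N + S j)%nat with (S N + j)%nat by lia. ring.
Qed.

(** For [1 <= j < c] the factors in [edge_coef c 0 j] are 1 except [acoef c c],
    which occurs at [i = j] and at [i = c]; the value is
    [2 (1 - c) + (c - 1 - j) = - (c + j - 1)].  For [j = c] the only term is
    [(1 - c)^2]. *)
Lemma edge_0 (c : nat) (b : nat -> C) :
  (2 <= c)%nat -> edge c b 0 = - head_term c b.
Proof.
  intros Hc. destruct c as [|[|d]]; [lia|lia|].
  unfold edge, head_term. rewrite csum_last by lia.
  replace (S (S d) - 2)%nat with d by lia.
  rewrite <- (csum_shift (fun j => edge_coef (S (S d)) 0 j * b (0 + j)%nat) 0 d).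
  rewrite (csum_ext _
    (fun i => - ((INR (S (S d)) + INR i) * b (i + 1)%nat)) 0 d).
  - rewrite csum_opp. unfold edge_coef. rewrite csum_single.
    replace (0 + S (S d) + S (S d) - S (S d))%nat with (S (S d)) by lia.
    rewrite acoef_self. simpl (0 + S (S d))%nat. ring.
  - intros i Hi. unfold edge_coef.
    rewrite csum_last, csum_first by lia.
    replace (0 + S i + S (S d) - S i)%nat with (S (S d)) by lia.
    replace (0 + S i + S (S d) - S (S d))%nat with (S i) by lia.
    rewrite acoef_self, (acoef_small _ (S i)) by lia.
    rewrite (csum_ext _ (fun _ => 1) (S (S i)) (S d)).
    + rewrite csum_one by lia.
      rewrite !S_INR, !RtoC_plus. replace (i + 1)%nat with (S i) by lia.
      simpl (0 + S i)%nat. ring.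
    + intros j Hj. rewrite !acoef_small by lia. ring.
Qed.

(** [edge_succ] telescopes: the sum of its right-hand sides is
    [edge c b (S N) - edge c b 0]. *)
Lemma partial_sum_delta (c : nat) (b : nat -> C) (N : nat) :
  (2 <= c)%nat ->
  sum_n (fun n => acoef c (S n) * delta c 1 b (S n)) N =
  head_term c b - INR c * sum_n (fun n => acoef c (S n) * b (S n)) N
  + edge c b (S N) :> C.
Proof.
  intros Hc.
  replace (head_term c b) with (- edge c b 0) by (rewrite edge_0 by lia; ring).
  pose proof (fun n => edge_succ c b n ltac:(lia)) as He.
  unfold sum_n. induction N as [|N IH].
  - rewrite !csum_single.
    replace (edge c b 1) with ((edge c b 1 - edge c b 0) + edge c b 0) by ring.
    rewrite He. ring.
  - rewrite !csum_last, IH by lia.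
    replace (edge c b (S (S N)))
      with ((edge c b (S (S N)) - edge c b (S N)) + edge c b (S N)) by ring.
    rewrite He. ring.
Qed.

(** * The edge vanishes in the limit *)

Lemma Cmod_csum_le (u : nat -> C) (v : nat -> R) (n m : nat) :
  (forall i, (n <= i <= m)%nat -> (Cmod (u i) <= v i)%R) ->
  (Cmod (sum_n_m u n m) <= sum_n_m v n m)%R.
Proof.
  induction m as [|m IH]; intros H.
  - destruct n as [|n].
    + rewrite csum_single, sum_n_n. apply H. lia.
    + rewrite csum_empty, sum_n_m_zero, Cmod_0 by lia. apply Rle_refl.
  - destruct (le_lt_dec n (S m)) as [Hn|Hn].
    + rewrite csum_last, sum_n_Sm by lia.
      eapply Rle_trans; [apply Cmod_triangle|].
      apply Rplus_le_compat; [apply IH; intros; apply H|apply H]; lia.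
    + rewrite csum_empty, sum_n_m_zero, Cmod_0 by lia. apply Rle_refl.
Qed.

(** At most [c] summands, each a product of two coefficients of modulus at most
    [c]; uniformity in [N] is what the limit needs. *)
Lemma Cmod_edge_coef_le (c N j : nat) :
  (1 <= c)%nat -> (1 <= j)%nat -> (Cmod (edge_coef c N j) <= INR c ^ 3)%R.
Proof.
  intros Hc Hj. pose proof (pos_INR c) as Hp.
  eapply Rle_trans.
  - apply (Cmod_csum_le _ (fun _ => INR c * INR c)%R). intros i _.
    rewrite Cmod_mult.
    apply Rmult_le_compat; auto using Cmod_ge_0, Cmod_acoef_le.
  - rewrite sum_n_m_const. replace (INR c ^ 3)%R with (INR c * (INR c * INR c))%R by ring.
    apply Rmult_le_compat_r; [nra|]. apply le_INR. lia.
Qed.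

Lemma is_lim_seq_sum_0 (u : nat -> nat -> R) (n m : nat) :
  (forall j, is_lim_seq (fun N => u N j) 0%R) ->
  is_lim_seq (fun N => sum_n_m (u N) n m) 0%R.
Proof.
  intros H. induction m as [|m IH].
  - destruct n as [|n].
    + apply is_lim_seq_ext with (2 := H O). intros N. now rewrite sum_n_n.
    + apply is_lim_seq_ext with (2 := is_lim_seq_const 0). intros N.
      now rewrite sum_n_m_zero by lia.
  - destruct (le_lt_dec n (S m)) as [Hn|Hn].
    + apply is_lim_seq_ext with (u := fun N => (sum_n_m (u N) n m + u N (S m))%R).
      * intros N. now rewrite sum_n_Sm by lia.
      * replace 0%R with (0 + 0)%R by ring. now apply is_lim_seq_plus'.
    + apply is_lim_seq_ext with (2 := is_lim_seq_const 0). intros N.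
      now rewrite sum_n_m_zero by lia.
Qed.

Lemma Clim_plus (u v : nat -> C) (lu lv : C) :
  filterlim u eventually (locally lu) ->
  filterlim v eventually (locally lv) ->
  filterlim (fun n => u n + v n) eventually (locally (lu + lv)).
Proof.
  intros Hu Hv.
  exact (filterlim_comp_2 _ _ _ Hu Hv
           (filterlim_plus (V := C_NormedModule) lu lv)).
Qed.

Lemma Clim_mult_l (z : C) (u : nat -> C) (l : C) :
  filterlim u eventually (locally l) ->
  filterlim (fun n => z * u n) eventually (locally (z * l)).
Proof.
  intros Hu.
  exact (filterlim_comp _ _ _ u _ _ _ _ Hu
           (filterlim_scal_r (V := C_NormedModule) z l)).
Qed.

Lemma Clim_succ (u : nat -> C) (l : C) :
  filterlim u eventually (locally l) ->
  filterlim (fun n => u (S n)) eventually (locally l).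
Proof.
  intros Hu. eapply filterlim_comp; [|exact Hu].
  apply eventually_subseq. intros; lia.
Qed.

Lemma series_terms_tend_to_0 (u : nat -> C) (l : C) :
  is_series u l -> is_lim_seq (fun n => Cmod (u n)) 0%R.
Proof.
  intros H.
  apply is_lim_seq_incr_1.
  apply is_lim_seq_ext
    with (u := fun n => Cmod (sum_n u (S n) + - (1) * sum_n u n)).
  - intros n. unfold sum_n. rewrite csum_last by lia. f_equal. ring.
  - rewrite <- Cmod_0. replace (RtoC 0) with (l + - (1) * l) by ring.
    eapply filterlim_comp; [|apply (filterlim_norm (V := C_NormedModule))].
    apply Clim_plus; [exact (Clim_succ _ l H)|exact (Clim_mult_l _ _ l H)].
Qed.

Lemma edge_tends_to_0 (c : nat) (b : nat -> C) (l : C) :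
  (2 <= c)%nat ->
  is_series (fun n => acoef c (S n) * b (S n)) l ->
  filterlim (edge c b) eventually (locally (0 : C)).
Proof.
  intros Hc Hs.
  assert (Hb : is_lim_seq (fun n => Cmod (b n)) 0%R).
  { apply is_lim_seq_incr_1.
    apply is_lim_seq_le_le with (u := fun _ => 0%R)
      (w := fun n => Cmod (acoef c (S n) * b (S n))).
    - intros n. split; [apply Cmod_ge_0|]. rewrite Cmod_mult.
      pose proof (Cmod_acoef_ge c (S n) Hc). pose proof (Cmod_ge_0 (b (S n))). nra.
    - apply is_lim_seq_const.
    - exact (series_terms_tend_to_0 _ l Hs). }
  apply (filterlim_norm_zero (V := C_NormedModule)).
  change (is_lim_seq (fun N => Cmod (edge c b N)) 0%R).
  apply is_lim_seq_le_le with (u := fun _ => 0%R)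
    (w := fun N => sum_n_m (fun j => INR c ^ 3 * Cmod (b (N + j)%nat))%R 1 c).
  - intros N. split; [apply Cmod_ge_0|].
    apply Cmod_csum_le. intros j Hj. rewrite Cmod_mult.
    apply Rmult_le_compat_r; [apply Cmod_ge_0|].
    apply Cmod_edge_coef_le; lia.
  - apply is_lim_seq_const.
  - apply (is_lim_seq_sum_0 (fun N j => INR c ^ 3 * Cmod (b (N + j)%nat))%R).
    intros j. replace (Finite 0%R) with (Rbar_mult (INR c ^ 3)%R 0%R)
      by (simpl; f_equal; ring).
    apply is_lim_seq_scal_l. now apply (is_lim_seq_incr_n (fun n => Cmod (b n)) j).
Qed.

(** * The first difference and its iteration *)

Lemma is_series_delta_1 (c : nat) (b : nat -> C) (l : C) :
  (2 <= c)%nat ->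
  is_series (fun n => acoef c (S n) * b (S n)) l ->
  is_series (fun n => acoef c (S n) * delta c 1 b (S n)) (head_term c b - INR c * l).
Proof.
  intros Hc Hs. unfold is_series.
  replace (head_term c b - INR c * l) with (head_term c b + - INR c * l + 0) by ring.
  apply filterlim_ext with (f := fun N =>
    head_term c b + - INR c * sum_n (fun n => acoef c (S n) * b (S n)) N
    + edge c b (S N)).
  { intros N. rewrite partial_sum_delta by exact Hc. ring. }
  apply Clim_plus.
  - apply Clim_plus; [apply filterlim_const|exact (Clim_mult_l _ _ l Hs)].
  - exact (Clim_succ _ _ (edge_tends_to_0 c b l Hc Hs)).
Qed.

(** Since [delta c (S k) b] unfolds to [delta c 1 (delta c k b)], the first
    difference step applies to the remainder series at every stage. *)
Lemma is_series_delta (c : nat) (b : nat -> C) (l : C) (k : nat) :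
  (2 <= c)%nat ->
  is_series (fun n => acoef c (S n) * b (S n)) l ->
  exists t : C,
    is_series (fun n => acoef c (S n) * delta c (S k) b (S n)) t /\
    l = sum_n_m (fun j => (-1) ^ j / INR c ^ (j + 1) * head_term c (delta c j b)) 0 k
        + (-1) ^ (S k) / INR c ^ (S k) * t.
Proof.
  intros Hc Hs.
  assert (Hc0 : RtoC (INR c) <> 0).
  { intros H. apply RtoC_inj in H. apply (not_0_INR c); [lia|exact H]. }
  induction k as [|k [t [Ht Hl]]].
  - exists (head_term c b - INR c * l). split; [now apply is_series_delta_1|].
    rewrite csum_single. simpl. change (fun n : nat => b n) with b.
    field. exact Hc0.
  - exists (head_term c (delta c (S k) b) - INR c * t). split.
    + exact (is_series_delta_1 c (delta c (S k) b) t Hc Ht).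
    + rewrite csum_last, Nat.add_1_r by lia. rewrite Hl at 1.
      rewrite !Cpow_S. field. split; [now apply Cpow_nz|exact Hc0].
Qed.

Theorem theorem3 :
  forall (c k : nat) (b : nat -> C) (Ac : C),
    (2 <= c)%nat -> (1 <= k)%nat ->
    is_series (fun n => (acoef c (S n) * b (S n))%C) Ac ->
    ex_series (fun n => (acoef c (S n) * delta c k b (S n))%C) /\
    exists T : C,
      is_series
        (fun n => ((-1) ^ k / INR c ^ k * acoef c (S n) * delta c k b (S n))%C) T /\
      Ac =
        (sum_n_m
           (fun j =>
              (-1) ^ j / INR c ^ (j + 1) *
              (sum_n_m (fun i => (INR c + INR i) * delta c j b (i + 1)%nat) 0 (c - 2)
               - (INR c - 1) ^ 2 * delta c j b c))
           0 (k - 1) + T)%C.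
Proof.
  intros c k b Ac Hc Hk Hs. destruct k as [|k]; [lia|].
  replace (S k - 1)%nat with k by lia.
  destruct (is_series_delta c b Ac k Hc Hs) as [t [Ht Hl]].
  split; [now exists t|].
  exists ((-1) ^ S k / INR c ^ S k * t). split; [|exact Hl].
  eapply is_series_ext; [|exact (is_series_scal ((-1) ^ S k / INR c ^ S k) _ _ Ht)].
  intros n. apply Cmult_assoc.
Qed.
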